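(* Let $\Gamma$ be a topological group, let the $\Gamma$-space $X$ be a geometric boundary, and let $\alpha,\beta:\Gamma\times X\to\mathbf R$ be two $B$-cocycles. Then $\ell_\alpha=\ell_\beta$ if and only if $[\alpha]=[\beta]$ in $H^1_c(\Gamma,X,\mathbf R)$, i.e. if and only if there is a continuous function $\varphi:X\to\mathbf R$ with $\alpha(\gamma,x)-\beta(\gamma,x)=\varphi(\gamma x)-\varphi(x)$ for all $\gamma\in\Gamma$, $x\in X$.
   Context: Hyperbolic elements: for a compact space $X$, a homeomorphism $\phi\ne \mathrm{Id}_X$ of $X$ is hyperbolic if it has two distinct fixed points $\phi^-,\phi^+\in X$ such that, as $n\to+\infty$, $\phi^n$ contracts $X\setminus\{\phi^-\}$ towards $\phi^+$ uniformly on compact subsets, and, as $n\to-\infty$, $\phi^n$ contracts $X\setminus\{\phi^+\}$ towards $\phi^-$ uniformly on compact subsets. The points $\phi^\pm$ are uniquely determined by $\phi$. An element $\gamma$ of a group acting on $X$ is called hyperbolic if it acts by a hyperbolic homeomorphism, and $\gamma^\pm$ denote its attracting/repelling fixed points. Geometric boundary: a nontrivial compact Hausdorff $\Gamma$-space $X$ ($\Gamma$ acting continuously) such that (1) $\Gamma$ acts on $X$ minimally; (2) every $\gamma\in\Gamma\setminus\{e\}$ is hyperbolic; (3) there are $\Gamma$-quasi-invariant measures $\mu,\mu'$ on $X$ such that the diagonal $\Gamma$-action on $(X\times X,\mu\times\mu')$ is ergodic. Measures are understood to be nonzero $\sigma$-finite regular Borel measures. Cocycles: a (continuous) cocycle is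 a continuous function $c:\Gamma\times X\to\mathbf R$ with $c(\gamma\eta,x)=c(\gamma,\eta x)+c(\eta,x)$. $H^1_c(\Gamma,X,\mathbf R)$ is the quotient of the vector space of continuous cocycles by the subspace of those of the form $(\gamma,x)\mapsto\varphi(\gamma x)-\varphi(x)$ with $\varphi:X\to\mathbf R$ continuous. A cocycle $c$ is a $B$-cocycle if $x\mapsto c(\gamma,x)$ is continuous for all $\gamma\in\Gamma$ and there is a continuous function $C:(X\times X)\setminus\Delta\to\mathbf R$ ($\Delta$ the diagonal) with $$C(\gamma x,\gamma y)-C(x,y)=c(\gamma,x)+c(\gamma,y)\qquad\text{for all }\gamma\in\Gamma,\ x\neq y\in X.$$ Marked length spectrum of a cocycle $\beta$: the function on conjugacy classes of nontrivial elements of $\Gamma$ given by $\ell_\beta(\langle\gamma\rangle)=\beta(\gamma,\gamma^+)$, $\gamma\in\Gamma\setminus\{e\}$. *)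

(* Defs.v *)
(* MathComp-Analysis; the reals are an arbitrary realType. *)
From HB Require Import structures.
From mathcomp Require Import all_boot all_order all_algebra.
From mathcomp Require Import all_classical all_reals all_analysis.
Set Implicit Arguments.
Unset Strict Implicit.
Unset Printing Implicit Defensive.
Import Order.TTheory GRing.Theory Num.Theory.
Import numFieldNormedType.Exports.
Local Open Scope classical_set_scope.
Local Open Scope ring_scope.

HB.mixin Record isTopologicalGroup G & Topological G & Group G := {
  mulg_continuous : continuous (fun p : G * G => (p.1 * p.2)%g) ;
  invg_continuous : continuous (fun g : G => (g^-1)%g)
}.

#[short(type="topologicalGroupType")]
HB.structure Definition TopologicalGroup :=
  {G of Topological G & Group G & isTopologicalGroup G}.

Section hyperbolic.
Variable X : topologicalType.

Definition contracts (u : nat -> X -> X) (r a : X) :=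
  forall K U : set X, compact K -> K `<=` ~` [set r] -> nbhs a U ->
    \forall n \near \oo, u n @` K `<=` U.

(* phi is a hyperbolic homeomorphism with phi^- = r and phi^+ = a; psi is the
   inverse of phi. *)
Definition hyperbolic_with (phi : X -> X) (r a : X) := exists psi : X -> X,
  [/\ cancel phi psi, cancel psi phi, continuous phi & continuous psi] /\
  [/\ phi <> id, r <> a, phi r = r & phi a = a] /\
  contracts (fun n => iter n phi) r a /\ contracts (fun n => iter n psi) a r.

Definition hyperbolic (phi : X -> X) := exists r a, hyperbolic_with phi r a.

End hyperbolic.

HB.instance Definition _ (X Y : ptopologicalType) :=
  Topological.on (X * Y)%type.

Definition borel (T : ptopologicalType) := g_sigma_algebraType (@open T).

Definition regular (R : realType) (T : ptopologicalType)
    (mu : set (borel T) -> \bar R) :=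
  forall A : set (borel T), measurable A ->
    mu A = ereal_inf [set mu U | U in [set U | open (U : set T) /\ A `<=` U]] /\
    mu A = ereal_sup [set mu K | K in [set K | compact (K : set T) /\ K `<=` A]].

(* X need not be second countable, so the Borel sigma-algebra of X * X may be
   strictly larger than the product of the Borel sigma-algebras, on which
   mu \x mu' lives.  The product of two regular Borel measures is understood as
   the (unique) regular Borel measure nu on X * X that extends mu \x mu'. *)
Definition is_product_measure (R : realType) (X : ptopologicalType)
    (mu mu' : set (borel X) -> \bar R)
    (nu : set (borel [the ptopologicalType of (X * X)%type]) -> \bar R) :=
  forall A : set (borel X * borel X), measurable A -> nu A = (mu \x mu')%E A.

Section actions.
Variable G : topologicalGroupType.

Record continuous_action (T : topologicalType) (act : G -> T -> T) : Prop := {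
  act1 : forall x, act 1%g x = x ;
  actM : forall g h x, act (g * h)%g x = act g (act h x) ;
  act_continuous : continuous (fun p : G * T => act p.1 p.2) }.

Definition minimal (T : topologicalType) (act : G -> T -> T) :=
  forall x, dense (range (act^~ x)).

Definition quasi_invariant d (T : measurableType d) (R : realType)
    (act : G -> T -> T) (mu : set T -> \bar R) :=
  forall g (A : set T), measurable A ->
    mu (act g @^-1` A) = 0%E <-> mu A = 0%E.

Definition ergodic d (T : measurableType d) (R : realType)
    (act : G -> T -> T) (mu : set T -> \bar R) :=
  forall A : set T, measurable A -> (forall g, act g @^-1` A = A) ->
    mu A = 0%E \/ mu (~` A) = 0%E.

Definition diagonal_action (T : Type) (act : G -> T -> T) (g : G) (p : T * T) :=
  (act g p.1, act g p.2).

(* The base point of X plays no role. *)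
Record geometric_boundary (R : realType) (X : ptopologicalType)
    (act : G -> X -> X) : Prop := {
  gb_nontrivial : exists x y : X, x <> y ;
  gb_compact : compact [set: X] ;
  gb_hausdorff : hausdorff_space X ;
  gb_action : continuous_action act ;
  gb_minimal : minimal act ;
  gb_hyperbolic : forall g, g <> 1%g -> hyperbolic (act g) ;
  gb_ergodic : exists mu mu' : {sigma_finite_measure set (borel X) -> \bar R},
    [/\ mu setT <> 0%E, regular mu & quasi_invariant (act : G -> borel X -> borel X) mu] /\
    [/\ mu' setT <> 0%E, regular mu' & quasi_invariant (act : G -> borel X -> borel X) mu'] /\
    exists nu : {measure set (borel [the ptopologicalType of (X * X)%type]) -> \bar R},
      [/\ regular nu, is_product_measure mu mu' nu &
          ergodic (diagonal_action act : G -> borel _ -> borel _) nu] }.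

End actions.

Section cocycles.
Variables (R : realType) (G : topologicalGroupType) (X : topologicalType).
Variable act : G -> X -> X.
Implicit Types c : G * X -> R.

Definition cocycle c := continuous c /\
  forall g h x, c ((g * h)%g, x) = c (g, act h x) + c (h, x).

Definition coboundary c := exists2 phi : X -> R, continuous phi &
  forall g x, c (g, x) = phi (act g x) - phi x.

(* the class of c in H^1_c(G, X, R), as a coset of the space of coboundaries *)
Definition H1_class c : set (G * X -> R) := [set c \+ b | b in coboundary].

Definition B_cocycle c := cocycle c /\
  (forall g, continuous (fun x => c (g, x))) /\
  exists2 C : X * X -> R, {within [set p | p.1 <> p.2], continuous C} &
    forall g x y, x <> y ->
      C (act g x, act g y) - C (x, y) = c (g, x) + c (g, y).

Definition conj_class (g : G) : set G := range (conjg g).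

Definition nontrivial_class :=
  {K : set G | exists2 g, g <> 1%g & K = conj_class g}.

Definition nontrivial_conj_class g (g1 : g <> 1%g) : nontrivial_class :=
  exist _ (conj_class g) (ex_intro2 _ _ g g1 erefl).

(* The set below is a singleton, see [marked_lengthE]. *)
Definition marked_length c (K : nontrivial_class) : R :=
  xget 0 [set l | exists g r a,
    [/\ sval K g, hyperbolic_with (act g) r a & l = c (g, a)]].

End cocycles.

Section facts.
Variable X : topologicalType.
Implicit Types (phi k : X -> X) (r a : X).

Lemma iter_fix phi a n : phi a = a -> iter n phi a = a.
Proof. by move=> e; elim: n => //= n ->. Qed.

Lemma contracts_pt (u : nat -> X -> X) r a x U : contracts u r a -> x <> r ->
  nbhs a U -> \forall n \near \oo, U (u n x).
Proof.
move=> c xr Ua; have K : [set x] `<=` ~` [set r] by move=> _ ->.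
have := c _ _ (@compact_set1 _ x) K Ua.
by apply: filterS => n; apply; exists x.
Qed.

Lemma contracts_common (u : nat -> X -> X) r a r' a' x : hausdorff_space X ->
  contracts u r a -> contracts u r' a' -> x <> r -> x <> r' -> a = a'.
Proof.
move=> hX c c' xr xr'; apply: hX => A B /(contracts_pt c xr) nA.
move=> /(contracts_pt c' xr') nB.
have [n [nAx nBx]] := filter_ex (filterI nA nB).
by exists (u n x).
Qed.

Lemma attracting_unique phi r a r' a' : hausdorff_space X ->
  hyperbolic_with phi r a -> hyperbolic_with phi r' a' -> a = a'.
Proof.
move=> hX [psi [_ [[nid ra fr fa] [c _]]]] [psi' [_ [[_ ra' fr' fa'] [c' _]]]].
have [x fx] : exists x, phi x <> x.
  by apply: contrapT => /forallNP e; apply: nid; apply/funext => x; apply: contrapT.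
have [xr|xr] := pselect (x = r); first by rewrite xr in fx.
have [xr'|xr'] := pselect (x = r'); first by rewrite xr' in fx.
exact: (contracts_common hX c c' xr xr').
Qed.

Lemma hyperbolic_with_conj phi k k' r a : cancel k k' -> cancel k' k ->
  continuous k -> continuous k' -> hyperbolic_with phi r a ->
  hyperbolic_with (k' \o phi \o k) (k' r) (k' a).
Proof.
move=> kK k'K kc k'c [psi [[pK p'K pc p'c] [[nid ra fr fa] [c c']]]].
have iterE (f : X -> X) n y : iter n (k' \o f \o k) y = k' (iter n f (k y)).
  by elim: n => [|n ih] /=; [rewrite kK|rewrite ih k'K].
have ctr f s b : contracts (fun n => iter n f) s b ->
    contracts (fun n => iter n (k' \o f \o k)) (k' s) (k' b).
  move=> cf K U cK Ks /k'c Ub.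
  have cK' : compact (k @` K) by apply: continuous_compact => //; exact/continuous_subspaceT.
  have Ks' : k @` K `<=` ~` [set s].
    by move=> _ [y Ky <-] /= e; apply: (Ks y Ky); rewrite /= -e kK.
  have := cf _ _ cK' Ks' Ub; apply: filterS => n sub _ [y Ky <-].
  by rewrite iterE; apply: (sub); exists (k y) => //; exists y.
exists (k' \o psi \o k); split; last split; last by split; exact: ctr.
  split.
  - by move=> y /=; rewrite k'K pK kK.
  - by move=> y /=; rewrite k'K p'K kK.
  - move=> y; apply: continuous_comp; first exact: kc.
    by apply: continuous_comp; [exact: pc|exact: k'c].
  - move=> y; apply: continuous_comp; first exact: kc.
    by apply: continuous_comp; [exact: p'c|exact: k'c].
split.
- move=> e; apply: nid; apply/funext => y.
  by have := congr1 (fun f => k (f (k' y))) e; rewrite /= !k'K.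
- by move=> e; apply: ra; rewrite -[r]k'K e k'K.
- by rewrite /= k'K fr.
- by rewrite /= k'K fa.
Qed.

End facts.

Lemma marked_lengthE (R : realType) (G : topologicalGroupType)
    (X : topologicalType) (act : G -> X -> X) (c : G * X -> R)
    (g : G) (g1 : g <> 1%g) (r a : X) :
  hausdorff_space X -> continuous_action act -> cocycle act c ->
  hyperbolic_with (act g) r a ->
  marked_length act c (nontrivial_conj_class g1) = c (g, a).
Proof.
move=> hX aX [_ cc] hg.
have actc h : continuous (act h).
  move=> x; apply: (@continuous_comp _ _ _ (fun x => (h, x)) (fun p => act p.1 p.2)).
    by apply: cvg_pair; [exact: cvg_cst|exact: cvg_id].
  exact: act_continuous.
apply: xget_unique.
  by exists g, r, a; split => //; exists 1%g => //; rewrite conjg1.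
move=> _ [_ [r' [a' [[k _ <-] hk ->]]]].
have kV : cancel (act k) (act k^-1%g) by move=> x; rewrite -actM// mulVg act1.
have Vk : cancel (act k^-1%g) (act k) by move=> x; rewrite -actM// mulgV act1.
have actE : act (conjg g k) = act k^-1%g \o act g \o act k.
  by apply/funext => x; rewrite conjgE !(actM aX).
rewrite actE in hk.
have -> : a' = act k^-1%g a.
  exact: attracting_unique hX hk (hyperbolic_with_conj kV Vk _ _ hg).
have fa : act g a = a by case: hg => psi [_ [[_ _ _]]].
have c1 : c (1%g, a) = 0.
  have e := cc 1%g 1%g a; rewrite mulg1 (act1 aX) in e.
  by apply: (addrI (c (1%g, a))); rewrite addr0 -e.
have ckV : c (k^-1%g, a) + c (k, act k^-1%g a) = 0.
  by rewrite addrC -cc mulgV c1.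
rewrite conjgE cc (actM aX) Vk fa cc Vk.
by rewrite addrC -addrA [X in _ + X]addrC ckV addr0.
Qed.

(* Main.v *)
(* Put c = alpha - beta, a B-cocycle vanishing at attracting points, with
   associated function C off the diagonal.  Ergodicity of the diagonal action
   gives topological transitivity on X * X, because minimality and compactness
   force open sets to have positive measure.  A Livsic argument on pairs then
   applies: if g almost fixes a pair (x, y) of distinct points, then g^+ is away
   from x or from y, and C(g^+, g x) - C(g^+, x) = c(g, x) shows that c(g, x) is
   small.  Hence c is the coboundary of a continuous function Phi of pairs.  The
   dynamics at repelling points, which are dense, shows that Phi(x, y) does not
   depend on y.  No dense orbit is used: X need not be second countable. *)
Require Import Defs.
From HB Require Import structures.
From mathcomp Require Import all_boot all_order all_algebra.
From mathcomp Require Import all_classical all_reals all_analysis.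
From mathcomp Require Import lra.
Set Implicit Arguments.
Unset Strict Implicit.
Unset Printing Implicit Defensive.
Import Order.TTheory GRing.Theory Num.Theory.
Import numFieldNormedType.Exports.
Local Open Scope classical_set_scope.
Local Open Scope ring_scope.

(** * Continuous actions and the density of repelling points *)

Lemma hausdorff_separated (T : topologicalType) (x y : T) :
  hausdorff_space T -> x <> y -> exists A B : set T,
  [/\ open A, open B, A x, B y & A `&` B = set0].
Proof.
rewrite open_hausdorff => hT /eqP /hT[[A B] /= []].
by rewrite !inE => Ax By [oA oB AB]; exists A, B.
Qed.

Lemma open_off_diagonal (T : topologicalType) : hausdorff_space T ->
  open [set p : T * T | p.1 <> p.2].
Proof.
move=> hT; rewrite openE => -[x y] /= xy.
have [A [B [oA oB Ax By AB]]] := hausdorff_separated hT xy.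
exists (A, B) => /=; first by split; apply: open_nbhs_nbhs.
move=> [a b] /= [Aa Bb] ab; rewrite -ab in Bb.
by have : (A `&` B) a by []; rewrite AB.
Qed.

Section actions.
Variables (G : topologicalGroupType) (T : topologicalType) (act : G -> T -> T).
Hypothesis aT : continuous_action act.

Lemma actV g : cancel (act g) (act g^-1%g).
Proof. by move=> x; rewrite -actM// mulVg act1. Qed.

Lemma actVK g : cancel (act g^-1%g) (act g).
Proof. by move=> x; rewrite -actM// mulgV act1. Qed.

Lemma act_inj g : injective (act g).
Proof. exact: can_inj (actV g). Qed.

Lemma continuous_act g : continuous (act g).
Proof.
move=> x; apply: (@continuous_comp _ _ _ (fun x => (g, x)) (fun p => act p.1 p.2)).
  by apply: cvg_pair; [exact: cvg_cst|exact: cvg_id].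
exact: act_continuous.
Qed.

Lemma continuous_diagonal_action g : continuous (diagonal_action act g).
Proof.
move=> p; apply: cvg_pair.
  by apply: (@continuous_comp _ _ _ fst (act g));
    [exact: cvg_fst|exact: continuous_act].
by apply: (@continuous_comp _ _ _ snd (act g));
  [exact: cvg_snd|exact: continuous_act].
Qed.

Lemma diagonal_actionM g h p :
  diagonal_action act (g * h)%g p = diagonal_action act g (diagonal_action act h p).
Proof. by rewrite /diagonal_action /= !actM. Qed.

Lemma diagonal_actV g : cancel (diagonal_action act g) (diagonal_action act g^-1%g).
Proof. by case=> x y; rewrite /diagonal_action /= !actV. Qed.

Lemma minimal_nontrivial : hausdorff_space T -> minimal act ->
  (exists x y : T, x <> y) -> exists g : G, g <> 1%g.
Proof.
move=> hT mT [x [y xy]]; apply: contrapT => /forallNP G1.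
have [A [B [oA oB Ax By AB]]] := hausdorff_separated hT xy.
have [z [Bz [g _ gz]]] := mT x B (ex_intro _ y By) oB.
have g1 : g = 1%g by apply: contrapT; exact: G1.
have : (A `&` B) x.
  by split => //; move: gz Bz; rewrite g1 act1// => ->.
by rewrite AB.
Qed.

(** Conjugating [g] by [k] moves its repelling point [r] to [act k r], so the whole orbit of [r]
    consists of repelling points, and minimality makes this orbit dense. *)
Lemma repelling_dense : hausdorff_space T -> minimal act ->
  (exists x y : T, x <> y) -> (forall g, g <> 1%g -> hyperbolic (act g)) ->
  dense [set r | exists g a, hyperbolic_with (act g) r a].
Proof.
move=> hT mT nT hyp U U0 oU.
have [g g1] := minimal_nontrivial hT mT nT.
have [r [a ha]] := hyp g g1.
have [z [Ux [k _ kr]]] := mT r U U0 oU.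
exists (act k r); split; first by rewrite kr.
exists (k * g * k^-1)%g, (act k a).
have -> : act (k * g * k^-1)%g = act k \o act g \o act k^-1%g.
  by apply/funext => x; rewrite !actM.
apply: (hyperbolic_with_conj _ _ _ _ ha).
- exact: actVK.
- exact: actV.
- exact: continuous_act.
- exact: continuous_act.
Qed.

(** * From ergodicity to topological transitivity on pairs *)

Definition topologically_transitive2 := forall U V : set (T * T),
  open U -> U !=set0 -> open V -> V !=set0 ->
  exists g q, V q /\ U (diagonal_action act g q).

End actions.

Lemma quasi_invariant_open_neq0 (R : realType) (G : topologicalGroupType)
    (X : ptopologicalType) (act : G -> X -> X)
    (mu : {measure set (borel X) -> \bar R}) (A : set X) :
  continuous_action act -> compact [set: X] -> minimal act ->
  mu setT <> 0%E -> quasi_invariant (act : G -> borel X -> borel X) mu ->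
  open A -> A !=set0 -> mu A <> 0%E.
Proof.
move=> aX cX mX muT qi oA A0 muA.
have mop (B : set X) : open B -> measurable (B : set (borel X)).
  exact: sub_sigma_algebra.
(* The filter of conull sets clusters at some [p], which has a null neighbourhood. *)
pose F : set_system X := [set B | mu.-negligible (~` (B : set (borel X)))].
have FF : ProperFilter F.
  split; last first.
    split; rewrite /F /=.
    - by rewrite setCT; exact: negligible_set0.
    - by move=> B C FB FC /=; rewrite setCI; exact: negligibleU.
    - by move=> B C BC; apply: negligibleS; exact: subsetC.
  rewrite /F /= setC0 => /negligibleP e; apply: muT; apply: e; exact: measurableT.
have [p [_ clp]] := cX F FF filterT.
(* By minimality the preimage of [A] under some [act g] contains [p]. Quasi-invariance makes it
   null, so its complement lies in [F], against [p] being a cluster point. *)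
have [z [Ag [g _ gp]]] := mX p A A0 oA.
have oB : open (act g @^-1` A).
  by apply: open_comp => // x _; exact: continuous_act.
have FB : F (~` (act g @^-1` A)).
  rewrite /F /= setCK; apply/negligibleP; first exact: mop.
  by apply/(qi g A (mop _ oA)).
have nB : nbhs p (act g @^-1` A).
  by apply: open_nbhs_nbhs; split => //; rewrite /preimage /= gp.
by have [x []] := clp _ _ FB nB.
Qed.

Lemma geometric_boundary_transitive (R : realType) (G : topologicalGroupType)
    (X : ptopologicalType) (act : G -> X -> X) :
  geometric_boundary R act -> topologically_transitive2 act.
Proof.
case=> _ cX _ aX mX _ [mu [mu' [[muT _ qi] [[mu'T _ qi'] [nu [_ nuE nue]]]]]].
move=> U V oU [u Uu] oV [v Vv].
(* An open rectangle around [w] inside [W] has as measure a product of two nonzero factors. The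
   superset [D] will be the saturation of [U], then its complement. *)
have pos (W : set (X * X)) w : open W -> W w ->
    forall D : set (borel [the ptopologicalType of (X * X)%type]),
    measurable D -> W `<=` D -> nu D <> 0%E.
  move=> oW Ww D mD WD nuD.
  have [[A B] /= [nA nB] ABW] : nbhs w W by apply: open_nbhs_nbhs.
  move: nA nB; rewrite !nbhsE => -[A' [oA A'w] A'A] [B' [oB B'w] B'B].
  have muA : mu A' <> 0%E.
    by apply: (quasi_invariant_open_neq0 aX cX mX muT qi oA); exists w.1.
  have muB : mu' B' <> 0%E.
    by apply: (quasi_invariant_open_neq0 aX cX mX mu'T qi' oB); exists w.2.
  have mA : measurable (A' : set (borel X)) by exact: sub_sigma_algebra.
  have mB : measurable (B' : set (borel X)) by exact: sub_sigma_algebra.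
  have mAB : measurable ((A' : set (borel X)) `*` (B' : set (borel X))).
    exact: measurableX.
  have := nuE _ mAB; rewrite product_measure1E//.
  have -> : nu (A' `*` B') = 0%E.
    apply/eqP; rewrite eq_le measure_ge0 andbT -nuD; apply: le_measure.
    - rewrite inE; apply: sub_sigma_algebra; apply: openI;
        apply: open_comp => // x _; [exact: cvg_fst|exact: cvg_snd].
    - by rewrite inE.
    - by move=> [x y] [/= Ax By]; apply/WD/ABW; split; [exact: A'A|exact: B'B].
  by move/esym/eqP; rewrite mule_eq0 => /orP[] /eqP.
apply: contrapT => nex.
(* The saturation of [U] is open and invariant, hence null or conull; it contains [U], and by [nex]
   its complement contains [V]. *)
pose W := \bigcup_g (diagonal_action act g @^-1` U).
have oW : open W.
  apply: bigcup_open => g _; apply: open_comp => // x _.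
  exact: continuous_diagonal_action.
have mW : measurable (W : set (borel [the ptopologicalType of (X * X)%type])).
  exact: sub_sigma_algebra.
have invW g : diagonal_action act g @^-1` W = W.
  apply/seteqP; split => p [h _ Uh].
    by exists (h * g)%g => //; rewrite /preimage /= diagonal_actionM.
  exists (h * g^-1)%g => //.
  by rewrite /preimage /= diagonal_actionM// diagonal_actV.
have [W0|W0] := nue W mW invW.
  apply: (pos U u oU Uu W mW _ W0) => p Up; exists 1%g => //.
  by case: p Up => x y; rewrite /preimage /diagonal_action /= !act1.
apply: (pos V v oV Vv (~` W) (measurableC mW) _ W0) => p Vp [g _ Ugp].
by apply: nex; exists g, p.
Qed.

(** * The Livsic argument on pairs *)

Section livsic.
Variables (R : realType) (G : topologicalGroupType) (X : topologicalType).
Variables (act : G -> X -> X) (c : G * X -> R) (C : X * X -> R).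
Hypotheses (aX : continuous_action act) (hX : hausdorff_space X).
Hypotheses (cX : compact [set: X]) (mX : minimal act).
Hypothesis nX : exists x y : X, x <> y.
Hypothesis hypX : forall g, g <> 1%g -> hyperbolic (act g).
Hypothesis trX : topologically_transitive2 act.
Hypothesis cM : forall g h x, c ((g * h)%g, x) = c (g, act h x) + c (h, x).
Hypothesis c_cont : forall g, continuous (fun x => c (g, x)).
Hypothesis C_cont : {within [set p | p.1 <> p.2], continuous C}.
Hypothesis CE : forall g x y, x <> y ->
  C (act g x, act g y) - C (x, y) = c (g, x) + c (g, y).
Hypothesis c_attr : forall g r a, g <> 1%g -> hyperbolic_with (act g) r a ->
  c (g, a) = 0.

Lemma C_near (p : X * X) (e : R) : p.1 <> p.2 -> 0 < e ->
  \forall q \near p, q.1 <> q.2 /\ `|C p - C q| < e.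
Proof.
move=> p12 e0; have oD := open_off_diagonal hX.
apply: filterI; first by apply: open_nbhs_nbhs; split.
move: C_cont; rewrite continuous_open_subspace// => /(_ p (mem_set p12)).
by move=> /cvgrPdist_lt; apply.
Qed.

(** The attracting point at which [C] will be evaluated is not known in advance, so the estimate has
    to be uniform in [k]. Compactness of [K] gives this from the local estimates at the pairs
    [(k, y)]. *)
Lemma C_near_compact (K : set X) (y : X) (e : R) : compact K -> ~ K y -> 0 < e ->
  \forall x \near y, forall k, K k -> k <> x /\ `|C (k, x) - C (k, y)| < e.
Proof.
move=> cK Ky e0.
apply: ((compact_near_coveringP K).1 cK X (nbhs y)
  (fun x k => k <> x /\ `|C (k, x) - C (k, y)| < e)) => k Kk.
have ky : k <> y by move=> ky; rewrite ky in Kk.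
have e20 : 0 < e / 2 by lra.
have nk := C_near (p := (k, y)) ky e20.
have nk1 : \forall k' \near k, `|C (k, y) - C (k', y)| < e / 2.
  have : (fun k' : X => (k', y)) @ k --> (k, y).
    by apply: cvg_pair; [exact: cvg_id|exact: cvg_cst].
  move=> /(_ _ nk) nk1.
  have : \forall k' \near k, k' <> y /\ `|C (k, y) - C (k', y)| < e / 2 := nk1.
  by apply: filterS => k' [].
have nk2 : \forall k' \near k & x \near y, `|C (k, y) - C (k', y)| < e / 2.
  by exists ([set k' | `|C (k, y) - C (k', y)| < e / 2], setT) => [|[? ?] []];
    [split => //; exact: filterT|].
apply: filterS2 nk nk2 => -[k' x] /= [k'x h1] h2; split => //.
move: h1 h2; rewrite !ltr_norml => /andP[? ?] /andP[? ?].
by apply/andP; split; lra.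
Qed.

(** This replaces the closing lemma of the classical Livsic argument: the attracting point of [g]
    stands in for a nearby periodic orbit. *)
Lemma cocycle_almost_return (p : X * X) (e : R) : p.1 <> p.2 -> 0 < e ->
  exists2 W : set (X * X), nbhs p W &
  forall g q, W q -> W (diagonal_action act g q) ->
    q.1 <> q.2 /\ `|c (g, q.1)| < e.
Proof.
(* At worst four errors add up: two for [C] at [(a, q.2)] and its image under [g], two for [C] at
   [q] and its image. *)
move=> p12 e0; have e40 : 0 < e / 4 by lra.
have [A [B [oA oB Ap Bp AB]]] := hausdorff_separated hX p12.
have cCl (D : set X) : open D -> compact (~` D).
  by move=> oD; apply: (subclosed_compact _ cX) => //; exact: open_closedC.
have nA := C_near_compact (cCl A oA) (fun h => h Ap) e40.
have nB := C_near_compact (cCl B oB) (fun h => h Bp) e40.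
have nC := C_near p12 e40.
have n1 : \forall q \near p, forall k, ~ A k ->
    k <> q.1 /\ `|C (k, q.1) - C (k, p.1)| < e / 4.
  exact: (@cvg_fst _ _ (nbhs p.1) (nbhs p.2) _ _ nA).
have n2 : \forall q \near p, forall k, ~ B k ->
    k <> q.2 /\ `|C (k, q.2) - C (k, p.2)| < e / 4.
  exact: (@cvg_snd _ _ (nbhs p.1) (nbhs p.2) _ _ nB).
eexists; first exact: (filterI nC (filterI n1 n2)).
move=> g q [[q12 Cq] [q1 q2]] [[gq12 Cgq] [gq1 gq2]]; split => //.
(* The identity has no attracting point, but the cocycle vanishes on it. *)
have [->|g1] := pselect (g = 1%g).
  have := cM 1%g 1%g q.1; rewrite mulg1 act1// => h.
  have -> : c (1%g, q.1) = 0 by lra.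
  by rewrite normr0.
have [r [a ha]] := hypX g1.
have ca := c_attr g1 ha.
have fa : act g a = a by case: ha => psi [_ [[_ _ _]]].
(* If [a] is close to [p.1], the estimate is obtained at [q.2] instead, and [h]
   transfers it to [q.1]. *)
have h := CE g q12; move: Cq Cgq h; rewrite /diagonal_action -surjective_pairing.
rewrite !ltr_norml => /andP[C1 C2] /andP[C3 C4] h.
have [Aa|Aa] := pselect (A a).
  have Ba : ~ B a by move=> Ba; have : (A `&` B) a by []; rewrite AB.
  have [aq2] := q2 a Ba; have [_] := gq2 a Ba.
  have := CE g aq2; rewrite fa ca /=.
  rewrite !ltr_norml => h' /andP[? ?] /andP[? ?].
  by apply/andP; split; lra.
have [aq1] := q1 a Aa; have [_] := gq1 a Aa.
have := CE g aq1; rewrite fa ca /=.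
rewrite !ltr_norml => h' /andP[? ?] /andP[? ?].
by apply/andP; split; lra.
Qed.

Lemma transitive_nbhs (p q : X * X) (U V : set (X * X)) : nbhs p U -> nbhs q V ->
  exists g v, V v /\ U (diagonal_action act g v).
Proof.
rewrite !nbhsE => -[U' [oU U'p] U'U] [V' [oV V'q] V'V].
have [g [v [Vv Ugv]]] := trX oU (ex_intro _ p U'p) oV (ex_intro _ q V'q).
by exists g, v; split; [exact: V'V|exact: U'U].
Qed.

Lemma c_near g (q : X * X) (e : R) : 0 < e ->
  \forall v \near q, `|c (g, q.1) - c (g, v.1)| < e.
Proof.
move=> e0; have : (fun v : X * X => c (g, v.1)) @ q --> c (g, q.1).
  by apply: (@continuous_comp _ _ _ fst (fun x => c (g, x)));
    [exact: cvg_fst|exact: c_cont].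
by move=> /cvgrPdist_lt; apply.
Qed.

(** Two transfers [g], [h] from near [q0] to near [p] differ by almost returns. If [k] carries a
    point near [q] to a point near [q'], then [k] is an almost return at [q0] and [h * k * g^-1] is
    one at [p], so [c] is small on both. *)
Lemma transfer_cauchy (q0 p : X * X) (e : R) :
  q0.1 <> q0.2 -> p.1 <> p.2 -> 0 < e ->
  exists U V : set (X * X), [/\ nbhs q0 V, nbhs p U &
    forall g h q q', V q -> V q' ->
      U (diagonal_action act g q) -> U (diagonal_action act h q') ->
      `|c (g, q.1) - c (h, q'.1)| < e].
Proof.
move=> q012 p12 e0; have e40 : 0 < e / 4 by lra.
have [V nV HV] := cocycle_almost_return q012 e40.
have [U nU HU] := cocycle_almost_return p12 e40.
(* Passing to interiors lets [q], [q'] and their images be perturbed without leaving [V] and [U]. *)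
exists (interior U), (interior V); split; try exact: nbhs_interior.
move=> g h q q' Vq Vq' Ugq Uhq'.
have n1 : nbhs q [set v | [/\ V v, U (diagonal_action act g v) &
    `|c (g, q.1) - c (g, v.1)| < e / 4]].
  have := continuous_diagonal_action aX Ugq.
  by apply: filterS3 (c_near g q e40) Vq => v.
have n2 : nbhs q' [set v | [/\ V v, U (diagonal_action act h v) &
    `|c (h, q'.1) - c (h, v.1)| < e / 4]].
  have := continuous_diagonal_action aX Uhq'.
  by apply: filterS3 (c_near h q' e40) Vq' => v.
have [k [v [[Vv Ugv cv] [Vkv Uhkv ckv]]]] := transitive_nbhs n2 n1.
have [_ ck] := HV k v Vv Vkv.
have := HU (h * k * g^-1)%g _ Ugv.
rewrite -diagonal_actionM// -mulgA mulVg mulg1 diagonal_actionM//.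
move=> /(_ Uhkv)[_] /=.
(* Both sides are the value of [c] on [h * k] at [v.1]. *)
have e1 : c ((h * k * g^-1)%g, act g v.1) + c (g, v.1)
    = c (h, act k v.1) + c (k, v.1).
  by rewrite -!cM -mulgA mulVg mulg1.
move: cv ckv ck; rewrite /= !ltr_norml.
move=> /andP[? ?] /andP[? ?] /andP[? ?] /andP[? ?].
by apply/andP; split; lra.
Qed.

Lemma transfer_lim (q0 p : X * X) : q0.1 <> q0.2 -> p.1 <> p.2 ->
  exists l : R, forall e, 0 < e ->
  exists U V : set (X * X), [/\ nbhs q0 V, nbhs p U &
    forall g q, V q -> U (diagonal_action act g q) -> `|l - c (g, q.1)| < e].
Proof.
move=> q012 p12.
(* The filter of transfer values is proper by transitivity and Cauchy by [transfer_cauchy]; [l] is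
   its limit. *)
pose F : set_system R := filter_from
  [set VU : set (X * X) * set (X * X) | nbhs q0 VU.1 /\ nbhs p VU.2]
  (fun VU => [set r | exists g q,
     [/\ VU.1 q, VU.2 (diagonal_action act g q) & r = c (g, q.1)]]).
have FF : ProperFilter F.
  apply: filter_from_proper; last first.
    move=> [V U] [/= nV nU]; have [g [v [Vv Uv]]] := transitive_nbhs nU nV.
    by exists (c (g, v.1)), g, v.
  apply: filter_from_filter; first by exists (setT, setT); split; exact: filterT.
  move=> [V U] [V' U'] [/= nV nU] [/= nV' nU'].
  exists (V `&` V', U `&` U') => [|_ [g [q [/= [Vq V'q] [Uq U'q] ->]]]].
    by split; exact: filterI.
  by split; exists g, q.
have FC : cauchy F.
  apply: cauchy_exP => e e0.
  have [U [V [nV nU UV]]] := transfer_cauchy q012 p12 e0.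
  have [g [v [Vv Uv]]] := transitive_nbhs nU nV.
  exists (c (g, v.1)), (V, U) => // _ [h [q [/= Vq Uq ->]]].
  exact: UV.
have /fcvgrPdist_lt Fl := R_complete FF FC.
exists (lim F) => e e0; have [[V U] [/= nV nU] VU] := Fl _ e0.
exists U, V; split => // g q Vq Uq.
by apply: VU; exists g, q.
Qed.

(* [Phi p] is the limit of [c (g, q.1)] as [q] tends to a base pair and [g q]
   tends to [p]; transitivity on pairs makes it defined everywhere. *)
Lemma transfer_function : exists Phi : X * X -> R,
  (forall p e, p.1 <> p.2 -> 0 < e -> \forall q \near p,
    q.1 <> q.2 -> `|Phi p - Phi q| < e) /\
  (forall g p, p.1 <> p.2 ->
    Phi (diagonal_action act g p) = Phi p + c (g, p.1)).
Proof.
have [x0 [y0 xy0]] := nX; pose q0 := (x0, y0).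
have /choice [Phi PhiP] : forall p : X * X, exists l : R, p.1 <> p.2 ->
    forall e, 0 < e -> exists U V : set (X * X), [/\ nbhs q0 V, nbhs p U &
      forall g q, V q -> U (diagonal_action act g q) -> `|l - c (g, q.1)| < e].
  move=> p; have [p12|p12] := pselect (p.1 <> p.2); last by exists 0 => /p12.
  by have [l lP] := @transfer_lim q0 p xy0 p12; exists l.
exists Phi; split.
  move=> p e p12 e0; have e20 : 0 < e / 2 by lra.
  have [U [V [nV nU H]]] := PhiP p p12 _ e20.
  have := nbhs_interior nU; apply: filterS => q Uq q12.
  have [U' [V' [nV' nU' H']]] := PhiP q q12 _ e20.
  (* As [U] is also a neighbourhood of [q], a single transfer lands in both [U] and [U'], and its
     value is close to both [Phi p] and [Phi q]. *)
  have [g [v [[Vv V'v] [Ugv U'gv]]]] :=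
    transitive_nbhs (filterI Uq nU') (filterI nV nV').
  have := H g v Vv Ugv; have := H' g v V'v U'gv.
  rewrite !ltr_norml => /andP[? ?] /andP[? ?].
  by apply/andP; split; lra.
move=> g p p12.
have gp12 : (diagonal_action act g p).1 <> (diagonal_action act g p).2.
  by move=> /(act_inj aX).
apply/eqP; rewrite -subr_eq0 -normr_le0; apply/ler_addgt0Pl => e e0; rewrite addr0.
have e30 : 0 < e / 3 by lra.
have [U [V [nV nU H]]] := PhiP p p12 _ e30.
have [U' [V' [nV' nU' H']]] := PhiP _ gp12 _ e30.
have nU2 := continuous_diagonal_action aX nU'.
(* The transfer [h] ends near [p] and [g * h] ends near the image of [p]; the cocycle identity
   relates their values. *)
have [h [v [[Vv V'v] [[Uhv U'ghv] cg]]]] :=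
  transitive_nbhs (filterI (filterI nU nU2) (c_near g p e30)) (filterI nV nV').
have := H h v Vv Uhv; have := H' (g * h)%g v V'v.
rewrite diagonal_actionM// => /(_ U'ghv); move: cg; rewrite cM /=.
rewrite !ltr_norml ler_norml => /andP[? ?] /andP[? ?] /andP[? ?].
by apply/andP; split; lra.
Qed.

(* At a repelling point [r = g^-] both [g^n y] and [g^n y'] tend to [g^+], so
   [Phi (r, y) - Phi (r, y')], which is invariant under [g], vanishes. *)
Lemma livsic : coboundary act c.
Proof.
have [Phi [PhiC PhiE]] := transfer_function.
have Phi_rep g r a y y' : hyperbolic_with (act g) r a -> y <> r -> y' <> r ->
    Phi (r, y) = Phi (r, y').
  move=> [psi [_ [[_ ra fr _] [ctr _]]]] yr y'r.
  have it n z : z <> r -> iter n (act g) z <> r.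
    move=> zr; elim: n => //= n ih; rewrite -[in X in _ <> X]fr.
    by move=> /(act_inj aX).
  (* Since [r] is fixed, each application of [g] adds the same [c (g, r)] to both terms. *)
  have inv n : Phi (r, iter n (act g) y) - Phi (r, iter n (act g) y')
      = Phi (r, y) - Phi (r, y').
    elim: n => //= n <-.
    have := PhiE g (r, iter n (act g) y) (fun h => it n y yr (esym h)).
    have := PhiE g (r, iter n (act g) y') (fun h => it n y' y'r (esym h)).
    by rewrite /diagonal_action /= fr => -> ->; lra.
  apply/eqP; rewrite -subr_eq0 -normr_le0; apply/ler_addgt0Pl => e e0; rewrite addr0.
  have e20 : 0 < e / 2 by lra.
  have nPhi := PhiC (r, a) _ ra e20.
  have na : \forall z \near a, r <> z -> `|Phi (r, a) - Phi (r, z)| < e / 2.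
    have : (fun z : X => (r, z)) @ a --> (r, a).
      by apply: cvg_pair; [exact: cvg_cst|exact: cvg_id].
    by move=> /(_ _ nPhi).
  have [n [Hy Hy']] := filter_ex
    (filterI (contracts_pt ctr yr na) (contracts_pt ctr y'r na)).
  rewrite -(inv n).
  have := Hy (fun h => it n y yr (esym h)); have := Hy' (fun h => it n y' y'r (esym h)).
  rewrite !ltr_norml ler_norml => /andP[? ?] /andP[? ?].
  by apply/andP; split; lra.
have ne (x y : X) : x <> y -> \forall z \near x, z <> y.
  move=> xy; have [A [B [oA oB Ax By AB]]] := hausdorff_separated hX xy.
  have : nbhs x A by apply: open_nbhs_nbhs.
  apply: filterS => z Az zy; rewrite -zy in By.
  by have : (A `&` B) z by []; rewrite AB.
have PhiC1 x y e : x <> y -> 0 < e ->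
    \forall z \near x, z <> y /\ `|Phi (x, y) - Phi (z, y)| < e.
  move=> xy e0; have nP := PhiC (x, y) _ xy e0.
  have : (fun z : X => (z, y)) @ x --> (x, y).
    by apply: cvg_pair; [exact: cvg_id|exact: cvg_cst].
  move=> /(_ _ nP) h'; have : \forall z \near x, z <> y ->
    `|Phi (x, y) - Phi (z, y)| < e := h'.
  apply: filterS2 (ne x y xy) => z zy /= h.
  by split => //; exact: h.
(* Independence of the second coordinate holds at repelling points arbitrarily close to [x] and
   passes to [x] by continuity in the first coordinate. *)
have Phi_fst x y y' : x <> y -> x <> y' -> Phi (x, y) = Phi (x, y').
  move=> xy xy'.
  apply/eqP; rewrite -subr_eq0 -normr_le0; apply/ler_addgt0Pl => e e0; rewrite addr0.
  have e20 : 0 < e / 2 by lra.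
  have : nbhs x [set r | (r <> y /\ `|Phi (x, y) - Phi (r, y)| < e / 2) /\
      (r <> y' /\ `|Phi (x, y') - Phi (r, y')| < e / 2)].
    by apply: filterI; exact: PhiC1.
  rewrite nbhsE => -[U [oU Ux] HU].
  have [r [Ur [g [a ha]]]] :=
    repelling_dense aX hX mX nX hypX (ex_intro _ x Ux) oU.
  have [[ry h] [ry' h']] := HU r Ur.
  have := Phi_rep g r a y y' ha (nesym ry) (nesym ry').
  move: h h'; rewrite !ltr_norml ler_norml => /andP[? ?] /andP[? ?] ?.
  by apply/andP; split; lra.
(* The choice of [s x] is arbitrary and need not be continuous or equivariant: [Phi_fst] lets [s z]
   be replaced by [s x] for continuity, and [s (act g x)] by [act g (s x)] for the cocycle
   equation. *)
have /choice [s sP] : forall x : X, exists y, x <> y.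
  move=> x; have [u [v uv]] := nX.
  have [xu|] := pselect (x = u); last by exists u.
  by exists v; rewrite xu.
exists (fun x => Phi (x, s x)).
  move=> x; apply/cvgrPdist_lt => e e0; apply: filterS (PhiC1 x (s x) e (sP x) e0).
  by move=> z [zy]; rewrite (Phi_fst z (s z) (s x)).
move=> g x; have gx : act g x <> act g (s x) by move=> /(act_inj aX); exact: sP.
rewrite (Phi_fst (act g x) _ (act g (s x)))//.
by have /= := PhiE g (x, s x) (sP x); rewrite /diagonal_action /= => ->; lra.
Qed.

End livsic.

(** * Cohomology classes and length spectra *)

Lemma H1_class_eq (R : realType) (G : topologicalGroupType) (X : topologicalType)
    (act : G -> X -> X) (alpha beta : G * X -> R) :
  H1_class act alpha = H1_class act beta <->
  exists phi : X -> R, continuous phi /\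
    forall g x, alpha (g, x) - beta (g, x) = phi (act g x) - phi x.
Proof.
have sub (a b : G * X -> R) (phi : X -> R) : continuous phi ->
    (forall g x, a (g, x) - b (g, x) = phi (act g x) - phi x) ->
    H1_class act a `<=` H1_class act b.
  move=> phic phiE _ [f [psi psic psiE] <-].
  exists (fun p => f p + (a p - b p)).
    exists (psi \+ phi) => [x|g x].
      by apply: continuousD; [exact: psic|exact: phic].
    by rewrite psiE phiE /=; lra.
  by apply/funext => p /=; lra.
split=> [e|[phi [phic phiE]]].
  have : H1_class act beta alpha.
    rewrite -e; exists (fun=> 0); last by apply/funext => p /=; rewrite addr0.
    by exists (fun=> 0) => [|g x]; [exact: cst_continuous|rewrite subrr].
  move=> [b [phi phic bE] <-]; exists phi; split => // g x /=.
  by rewrite -bE; lra.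
apply/seteqP; split; first exact: (sub _ _ phi).
apply: (sub _ _ (\- phi)) => [x|g x]; first by apply: continuousN; exact: phic.
by rewrite /= -opprB phiE; lra.
Qed.

(** An element of the subtype carries its own proof of nontriviality; proof irrelevance allows it to
    be exchanged for the one built from [g1]. *)
Lemma nontrivial_classP (G : topologicalGroupType) (K : nontrivial_class G) :
  exists (g : G) (g1 : g <> 1%g), K = nontrivial_conj_class g1.
Proof. by case: K => K [g g1 e]; exists g, g1; exact: eq_exist. Qed.

Theorem theorem3 (R : realType) (Gamma : topologicalGroupType)
    (X : ptopologicalType) (act : Gamma -> X -> X)
    (alpha beta : Gamma * X -> R) :
  geometric_boundary R act ->
  B_cocycle act alpha -> B_cocycle act beta ->
  (marked_length act alpha = marked_length act beta <->
   H1_class act alpha = H1_class act beta) /\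
  (H1_class act alpha = H1_class act beta <->
   exists phi : X -> R, continuous phi /\
     forall (gamma : Gamma) (x : X),
       alpha (gamma, x) - beta (gamma, x) = phi (act gamma x) - phi x).
Proof.
move=> gb [calpha [alpha_cont [A A_cont AE]]] [cbeta [beta_cont [B B_cont BE]]].
split; last exact: H1_class_eq.
have trX := geometric_boundary_transitive gb.
case: gb => nX cX hX aX mX hypX _; rewrite H1_class_eq; split.
  move=> len.
  have : coboundary act (alpha \- beta); last first.
    by move=> [phi phic phiE]; exists phi; split => // g x; rewrite -phiE.
  (* The B-cocycle identity is linear, so [A \- B] serves the difference. *)
  apply: (@livsic _ _ _ _ _ (A \- B)) => //.
  - by move=> g h x /=; rewrite calpha.2 cbeta.2; lra.
  - by move=> g x; apply: continuousB; [exact: alpha_cont|exact: beta_cont].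
  - by move=> x; apply: continuousB; [exact: A_cont|exact: B_cont].
  - by move=> g x y xy /=; have := AE g x y xy; have := BE g x y xy; lra.
  move=> g r a g1 ha /=.
  rewrite -(marked_lengthE g1 hX aX calpha ha) -(marked_lengthE g1 hX aX cbeta ha).
  by rewrite len subrr.
move=> [phi [_ phiE]]; apply/funext => K.
have [g [g1 ->]] := nontrivial_classP K.
have [r [a ha]] := hypX g g1.
rewrite !(marked_lengthE g1 hX aX _ ha)//; apply/eqP.
(* The attracting point is fixed by [g], so the coboundary vanishes there. *)
rewrite -subr_eq0 phiE; case: ha => psi [_ [[_ _ _ ->] _]].
by rewrite subrr.
Qed.
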